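(* Let $G$ be a finite simple graph without isolated vertices, with minimum degree $\delta$ and $m$ edges, and let $a \in \mathbb{R}$. (1) If $a>0$, then $$ISD_a(G) + M_1^{a+1}(G) \ge \Big(2\delta^a + \frac{1}{2\delta^a}\Big) m.$$ (2) If $\delta>1$ and $a \le -\log 2/\log\delta$, then $$ISD_a(G) + M_1^{a+1}(G) \ge \Big(2\delta^a + \frac{1}{2\delta^a}\Big) m.$$ In each bound, equality is attained if and only if $G$ is regular.
   Context: Graphs are undirected, finite, nonempty, simple (no loops, no multiple edges), without isolated vertices, and not necessarily connected. $d_u$ denotes the degree of the vertex $u$, and $uv$ denotes the (unordered) edge joining $u$ and $v$; sums over $uv\in E(G)$ run once over each edge. For $a\in\mathbb{R}$ the variable inverse sum deg index is $$ISD_a(G)=\sum_{uv\in E(G)}\frac{1}{d_u^a+d_v^a}.$$ For $b\in\mathbb{R}$ the variable first Zagreb index is $$M_1^{b}(G)=\sum_{u\in V(G)}d_u^{b}$$ (the superscript $b$ is a parameter, not a power). A graph is regular if all its vertices have the same degree. *)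

(* Defs.v *)
From mathcomp Require Import all_boot all_order all_algebra.
From mathcomp Require Import reals exp.

Set Implicit Arguments.
Unset Strict Implicit.
Unset Printing Implicit Defensive.

Import Order.TTheory GRing.Theory Num.Theory.

Record sgraph := SGraph {
  vertex :> finType;
  adj : rel vertex;
  adj_sym : symmetric adj;
  adj_irrefl : irreflexive adj
}.

Definition degree (G : sgraph) (u : G) : nat := #|[set v : G | adj u v]|.

(* The edge uv is the unordered pair [set u; v], which has two distinct
   elements since adj is irreflexive. *)
Definition edges (G : sgraph) : {set {set G}} :=
  [set [set uv.1; uv.2] | uv : G * G & adj uv.1 uv.2].

Definition no_isolated (G : sgraph) : Prop :=
  forall u : G, exists v : G, adj u v.

(* The default value #|G| is only reached on the empty graph, since every degree
   is less than #|G|. *)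
Definition min_degree (G : sgraph) : nat :=
  \big[minn/#|G|]_(u : G) degree u.

Definition regular (G : sgraph) : Prop :=
  forall u v : G, degree u = degree v.

Local Open Scope ring_scope.

(* Sums over edges range over the unordered pairs E = {u, v}; the inner sum over
   the two ends of E is d_u^a + d_v^a. *)
Definition ISD (R : realType) (a : R) (G : sgraph) : R :=
  \sum_(E in edges G) (1 / \sum_(u in E) powR (degree u)%:R a).

Definition zagreb1 (R : realType) (b : R) (G : sgraph) : R :=
  \sum_(u : G) powR (degree u)%:R b.

Lemma min_degree_le (G : sgraph) (u : G) : (min_degree G <= degree u)%N.
Proof.
rewrite /min_degree; have: u \in index_enum G by rewrite mem_index_enum.
elim: (index_enum G) => // w s IHs; rewrite in_cons big_cons geq_min.
by case/orP=> [/eqP->|/IHs->]; rewrite ?leqnn ?orbT.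
Qed.

Lemma min_degree_attained (G : sgraph) :
  (0 < #|G|)%N -> exists u : G, degree u = min_degree G.
Proof.
case/card_gt0P=> u0 _.
have dlt (u : G) : (degree u < #|G|)%N.
  rewrite -cardsT; apply/proper_card/properP; split; first exact: subsetT.
  by exists u; rewrite ?inE ?adj_irrefl.
have [[u ud]|] : (exists u : G, degree u = min_degree G) \/ min_degree G = #|G|.
- rewrite /min_degree; elim/big_ind: _ => [|x y Hx Hy|u _]; first by right.
    by rewrite /minn; case: ifP.
  by left; exists u.
- by exists u.
by move=> mE; move: (dlt u0); rewrite ltnNge -mE min_degree_le.
Qed.

Lemma sum_edge_ends (R : nmodType) (G : sgraph) (f : G -> R) (u v : G) :
  adj u v -> \sum_(w in [set u; v]) f w = f u + f v.
Proof.
move=> uv; rewrite big_setU1 ?big_set1 // inE.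
by apply: contraTneq uv => ->; rewrite adj_irrefl.
Qed.

(* Main.v *)
Require Import Defs.
From mathcomp Require Import all_boot all_order all_algebra.
From mathcomp Require Import reals exp.
From mathcomp Require Import ring lra.

(** Put [s_E = d_u^a + d_v^a] for an edge [E = uv]. Counting each vertex once
    for every edge through it turns [M_1^{a+1} = \sum_u d_u * d_u^a] into
    [\sum_E s_E] ([sum_over_edge_ends]), so the left-hand side of the theorem
    is [\sum_E (s_E + 1 / s_E)], while the bound is the same sum with every
    [s_E] replaced by [2 delta^a].

    The function [x + 1 / x] decreases strictly on [(0, 1]] and increases
    strictly from [1] on. If [a > 0], then [1 <= 2 delta^a <= s_E]; in the second
    case the condition on [a] says exactly that [2 delta^a <= 1], and [a < 0]
    gives [s_E <= 2 delta^a]. In both cases [s_E] lies farther from [1] than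
    [2 delta^a], on the same side, so each edge term is at least the
    corresponding term of the bound ([add_inv_leif]). Equality forces
    [s_E = 2 delta^a] on every edge, hence [d_u^a = delta^a] at both ends since
    these differ from [delta^a] in the same direction. As no vertex is isolated
    and [x^a] is injective for [a != 0], every degree is then [delta]. *)

Import Order.TTheory GRing.Theory Num.Theory.

Local Open Scope ring_scope.

(** * Edges and degrees *)

Lemma edgesP (G : sgraph) (E : {set G}) :
  reflect (exists u v : G, adj u v /\ E = [set u; v]) (E \in edges G).
Proof.
apply: (iffP imsetP) => [[[u v] uv ->]|[u [v [uv ->]]]].
  by rewrite inE /= in uv; exists u, v.
by exists (u, v); rewrite ?inE.
Qed.

(** The map [v |-> {u, v}] is a bijection from the neighbours of [u] to the
    edges through [u]. *)
Lemma card_edges_at (G : sgraph) (u : G) :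
  #|[set E in edges G | u \in E]| = degree u.
Proof.
rewrite /degree -(card_in_imset (f := fun v => [set u; v])); last first.
  move=> v w; rewrite !inE => uv uw vw.
  have : v \in [set u; w] by rewrite -vw !inE eqxx orbT.
  by rewrite !inE => /orP[/eqP vu|/eqP//]; rewrite vu adj_irrefl in uv.
apply: eq_card => E; rewrite inE; apply/andP/imsetP => [[]|[v]].
  case/edgesP=> x [y [xy ->]]; rewrite !inE => /orP[] /eqP->.
    by exists y; rewrite ?inE.
  by exists x; rewrite ?inE 1?adj_sym // setUC.
rewrite inE => uv ->; rewrite !inE eqxx; split=> //.
by apply/edgesP; exists u, v.
Qed.

Lemma sum_over_edge_ends (V : nmodType) (G : sgraph) (g : G -> V) :
  \sum_(E in edges G) \sum_(u in E) g u = \sum_(u : G) g u *+ degree u.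
Proof.
rewrite (exchange_big_dep xpredT) //=; apply: eq_bigr => u _.
by rewrite sumr_const -card_edges_at; congr (_ *+ _); apply: eq_card => E;
  rewrite !inE.
Qed.

Lemma degree_gt0 (G : sgraph) (u : G) : no_isolated G -> (0 < degree u)%N.
Proof. by case/(_ u) => v uv; apply/card_gt0P; exists v; rewrite inE. Qed.

Lemma min_degree_gt0 (G : sgraph) :
  (0 < #|G|)%N -> no_isolated G -> (0 < min_degree G)%N.
Proof. by move=> /min_degree_attained[u <-] ?; apply: degree_gt0. Qed.

Lemma regular_min_degree (G : sgraph) : (0 < #|G|)%N ->
  regular G <-> (forall u : G, degree u = min_degree G).
Proof.
case/min_degree_attained => w <-; split=> [reg u|eqd u v]; first exact: reg.
by rewrite !eqd.
Qed.

(** * Comparing weights with a constant lying between them and 1 *)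

(** The difference of the two sides is [(x - c) * (c * x - 1) / (c * x)], whose
    numerator is a product of two factors of the same sign. *)
Lemma add_inv_leif (R : realFieldType) (c x : R) : 0 < c -> 0 < x ->
  (1 <= c /\ c <= x) \/ (c <= 1 /\ x <= c) ->
  c + 1 / c <= x + 1 / x ?= iff (x == c).
Proof.
move=> c0 x0 side.
have cx0 : 0 < c * x by rewrite mulr_gt0.
have diffE : x + 1 / x - (c + 1 / c) = (x - c) * (c * x - 1) / (c * x).
  by field; rewrite !gt_eqF.
split.
  rewrite -subr_ge0 diffE divr_ge0 ?(ltW cx0) //.
  case: side => -[c1 cx].
    by rewrite mulr_ge0 ?subr_ge0 ?mulr_ege1 ?(le_trans c1).
  have x1 := le_trans cx c1.
  by rewrite mulr_le0 ?subr_le0 ?mulr_ile1 ?(ltW c0) ?(ltW x0).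
rewrite eq_sym -subr_eq0 diffE !mulf_eq0 invr_eq0 (gt_eqF cx0) orbF !subr_eq0.
(* When [c * x = 1], both numbers are 1, as they lie on the same side of 1. *)
apply/orP/eqP => [[/eqP//|/eqP cx1]|->]; last by left.
by clear diffE; apply/le_anti/andP; case: side => -[c1 cx]; split; nra.
Qed.

Lemma addr_eq_double (R : realFieldType) (c x y : R) :
  (c <= x /\ c <= y) \/ (x <= c /\ y <= c) ->
  (x + y == 2 * c) = (x == c) && (y == c).
Proof.
move=> side; apply/eqP/andP => [xy|[/eqP-> /eqP->]]; last by ring.
by split; apply/eqP; case: side => -[cx cy]; lra.
Qed.

(** The common form of both bounds: [phi u] stands for [d_u^a] and [c] for
    [delta^a]. *)
Lemma edge_sum_leif (R : realFieldType) (G : sgraph) (phi : G -> R) (c : R) :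
  no_isolated G -> 0 < c -> (forall u, 0 < phi u) ->
  (1 <= 2 * c /\ forall u, c <= phi u) \/
    (2 * c <= 1 /\ forall u, phi u <= c) ->
  (2 * c + 1 / (2 * c)) * #|edges G|%:R <=
    \sum_(E in edges G) (1 / \sum_(u in E) phi u) +
    \sum_(u : G) phi u *+ degree u ?= iff [forall u, phi u == c].
Proof.
move=> noiso c0 phi0 side.
rewrite -sum_over_edge_ends -big_split /= mulr_natr -sumr_const.
have -> : [forall u, phi u == c] =
    [forall (E | E \in edges G), \sum_(u in E) phi u == 2 * c].
  have endsE u v : (phi u + phi v == 2 * c) = (phi u == c) && (phi v == c).
    by apply: addr_eq_double; case: side => -[_ h]; [left|right]; split.
  apply/forallP/forall_inP => [eqc E /edgesP[u [v [uv ->]]]|eqc u].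
    by rewrite sum_edge_ends // endsE !eqc.
  have [v uv] := noiso u.
  have /eqc : [set u; v] \in edges G by apply/edgesP; exists u, v.
  by rewrite sum_edge_ends // endsE => /andP[].
apply: leif_sum => E /edgesP[u [v [uv ->]]].
rewrite sum_edge_ends // [X in _ <= X ?= iff _]addrC.
have [pu pv] := (phi0 u, phi0 v).
apply: add_inv_leif; [lra | lra | ].
by case: side => -[c1 h]; [left|right]; split=> //;
  have := h u; have := h v; lra.
Qed.

(** * Powers of degrees *)

Lemma zagreb1_succ (R : realType) (a : R) (G : sgraph) : no_isolated G ->
  zagreb1 (a + 1) G = \sum_(u : G) powR (degree u)%:R a *+ degree u.
Proof.
move=> noiso; apply: eq_bigr => u _.
have d0 : (degree u)%:R != 0 :> R by rewrite pnatr_eq0 -lt0n degree_gt0.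
by rewrite powRD ?d0 ?implybT // powRr1 ?ler0n // mulr_natr.
Qed.

(** On positive reals [ln (x^a) = a * ln x], and both [ln] and multiplication
    by [a != 0] are injective. *)
Lemma powR_injective (R : realType) (a x y : R) : a != 0 -> 0 < x -> 0 < y ->
  powR x a = powR y a -> x = y.
Proof.
move=> a0 x0 y0 /(congr1 (@ln R)); rewrite !ln_powR => /(mulfI a0).
by apply: ln_inj; rewrite posrE.
Qed.

Lemma le0_ler_powR (R : realType) (a x y : R) : a <= 0 -> 0 < x -> x <= y ->
  powR y a <= powR x a.
Proof.
move=> a0 x0 xy; have y0 := lt_le_trans x0 xy.
rewrite /powR !gt_eqF // ler_expR; apply: ler_wnM2l => //.
by rewrite ler_ln ?posrE.
Qed.

(** The sign of [a] and the size of [delta] enter only through the side of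
    [delta^a] on which the powers lie; [a != 0] is what turns equal powers back
    into equal degrees. *)
Lemma ISD_add_zagreb1_ge (R : realType) (G : sgraph) (a : R) :
  let c : R := powR (min_degree G)%:R a in
  let lhs : R := ISD a G + zagreb1 (a + 1) G in
  let bound : R := (2 * c + 1 / (2 * c)) * #|edges G|%:R in
  (0 < #|G|)%N -> no_isolated G -> a != 0 ->
  (1 <= 2 * c /\ forall u : G, c <= powR (degree u)%:R a) \/
    (2 * c <= 1 /\ forall u : G, powR (degree u)%:R a <= c) ->
  bound <= lhs /\ (lhs = bound <-> regular G).
Proof.
move=> c lhs bound G0 noiso a0 side.
have dmin0 : 0 < (min_degree G)%:R :> R by rewrite ltr0n min_degree_gt0.
have d0 (u : G) : 0 < (degree u)%:R :> R by rewrite ltr0n degree_gt0.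
have c0 : 0 < c by rewrite powR_gt0.
have phi0 (u : G) : 0 < powR (degree u)%:R a :> R by rewrite powR_gt0.
have [le_bound eq_bound] := edge_sum_leif _ _ _ _ noiso c0 phi0 side.
rewrite -zagreb1_succ // in le_bound eq_bound.
split=> //; rewrite regular_min_degree //.
split=> [lhsE u|reg].
  have /forallP/(_ u)/eqP dc : [forall u : G, powR (degree u)%:R a == c].
    by rewrite -eq_bound; apply/eqP/esym.
  by apply/eqP; rewrite -(eqr_nat R); apply/eqP/(powR_injective R a).
by apply/esym/eqP; rewrite eq_bound; apply/forallP => u; rewrite reg.
Qed.

Theorem theorem7 (R : realType) (G : sgraph) (a : R) :
  (0 < #|G|)%N -> no_isolated G ->
  let delta : R := (min_degree G)%:R in
  let m : R := #|edges G|%:R in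
  let lhs : R := ISD a G + zagreb1 (a + 1) G in
  let bound : R := (2 * powR delta a + 1 / (2 * powR delta a)) * m in
  (0 < a -> bound <= lhs /\ (lhs = bound <-> regular G)) /\
  (1 < delta -> a <= - ln 2 / ln delta ->
     bound <= lhs /\ (lhs = bound <-> regular G)).
Proof.
move=> G0 noiso delta m lhs bound.
have delta1 : 1 <= delta by rewrite ler1n min_degree_gt0.
have delta0 : 0 < delta by apply: lt_le_trans delta1.
have delta_le (u : G) : delta <= (degree u)%:R by rewrite ler_nat min_degree_le.
split=> [a0|delta_gt1 a_le].
  apply: ISD_add_zagreb1_ge; rewrite ?gt_eqF //; left; split=> [|u].
    have : 1 <= powR delta a.
      have <- : powR 1 a = 1 by rewrite powR1.
      by apply: ge0_ler_powR; rewrite ?nnegrE // ltW.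
    by rewrite /delta; lra.
  by apply: ge0_ler_powR; rewrite ?nnegrE // ?ler0n // ltW.
have lnd0 : 0 < ln delta by rewrite ln_gt0.
have ln2_gt0 : 0 < ln 2 :> R by rewrite ln_gt0 // ltr1n.
have a0 : a < 0.
  by apply: le_lt_trans a_le _; rewrite mulNr oppr_lt0 divr_gt0.
apply: ISD_add_zagreb1_ge; rewrite ?lt_eqF //; right; split=> [|u].
  rewrite -[leLHS]lnK ?posrE ?mulr_gt0 ?powR_gt0 // -[leRHS]expR0 ler_expR.
  rewrite lnM ?posrE ?powR_gt0 // ln_powR.
  by rewrite ler_pdivlMr // in a_le; rewrite -/delta; lra.
by apply: le0_ler_powR => //; apply: ltW.
Qed.
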